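(* Let $V=V_1\uplus\cdots\uplus V_k$ be a finite ground set partitioned into disjoint nonempty sets, let $b_1,\dots,b_k$ be integers with $1\le b_i\le n_i:=|V_i|$, let $n=|V|$, $b=\sum_{i\in[k]}b_i$, $\bar n=\max_i n_i$, and let $f:2^V\to\mathbb{R}_{\ge 0}$ be monotone with $f(\emptyset)=0$. Let $\gamma,\alpha$ be the partition matroid diminishing-return ratio and partition matroid curvature of $f$ (defined in the context), let $0<\gamma'\le\gamma$ and $\alpha\le\alpha'\le1$, and let $\delta\in[0,1]$. Let $S_b$ be the output of the algorithm \textsc{FastProb} (described in the context), and let $S^*$ maximize $f(S)$ over $\{S\subseteq V:|S\cap V_i|\le b_i\ \forall i\}$. Then, with probability at least $1-\delta$, \textsc{FastProb} obtains a $\Big(\frac{1}{\gamma'}+\alpha'-1\Big)\Big(1-\frac{1}{\bar n+2}\Big)+1$-approximation solution, i.e. $f(S^* )\le\big[(\frac{1}{\gamma'}+\alpha'-1)(1-\frac{1}{\bar n+2})+1\big]\mathbb{E}[f(S_b)]$; and \textsc{FastProb} uses $O(n\ln b\ln\frac{b}{\delta})$ queries of $f$.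
   Context: Notation: $\Delta_e f(S):=f(S\cup\{e\})-f(S)$ for $e\notin S$. The PM diminishing-return ratio $\gamma$ is the maximum value in $[0,1]$ with $\Delta_e f(T)\le\frac1\gamma\Delta_e f(S)$ for all $S\subseteq T\subseteq V$ with $|(T\setminus S)\cap V_i|\le b_i\ \forall i\in[k]$ and all $e\in V\setminus T$; the PM curvature $\alpha$ is the minimum value in $[0,1]$ with $\Delta_e f(T)\ge(1-\alpha)\Delta_e f(S)$ for all such $S,T,e$. Algorithm \textsc{FastProb} (input: partition, $f$, $\gamma'$, $\alpha'$, $b_1,\dots,b_k$, $\delta$): set $I=[k]$, $S_0=\emptyset$, $t=0$. While $I\neq\emptyset$: for each $i\in I$ in turn: let $R_t$ be a set of $\min\big(\frac{n_i-|S_t\cap V_i|}{b_i-|S_t\cap V_i|}\ln\frac b\delta,\ |V_i\setminus S_t|\big)$ elements picked uniformly at random from $V_i\setminus S_t$; let $a=\big\lceil\frac{|R_t|+1}{1-\gamma'(1-\alpha')}\big\rceil-1$; choose $e_t\in R_t$ with probability $\frac{(\Delta_{e_t}f(S_t))^a}{\sum_{u\in R_t}(\Delta_u f(S_t))^a}$; set $S_{t+1}=S_t\cup\{e_t\}$, $t=t+1$; if $|S_t\cap V_i|\ge b_i$ remove $i$ from $I$. Return $S_b$.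
   Formalization: Query bound is for b≥2, δ>0 (at b=1 the formula is 0). |R_t| is rounded up, at least 1; if γ'(1−α')=1 or all weights vanish, e_t is uniform among elements of R_t of largest marginal. E[f(S_b)] is conditional on an event about the samples of probability ≥1−δ. *)

(* Defs.v *)
From HB Require Import structures.
From mathcomp Require Import all_boot all_order all_algebra.
From mathcomp Require Import reals exp.

Set Implicit Arguments.
Unset Strict Implicit.
Unset Printing Implicit Defensive.

Import Order.TTheory GRing.Theory Num.Theory.
Local Open Scope ring_scope.

Section SetFunctions.
Context {R : realType} {V : finType} {k : nat}.
Variables (Vs : 'I_k -> {set V}) (cap : 'I_k -> nat) (f : {set V} -> R).

Definition is_partition : Prop :=
  [/\ forall i, Vs i != set0,
      forall i j, i != j -> [disjoint Vs i & Vs j]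
    & \bigcup_(i : 'I_k) Vs i = [set: V]].

Definition monotone : Prop :=
  forall S T : {set V}, S \subset T -> f S <= f T.

Definition marginal (e : V) (S : {set V}) : R := f (e |: S) - f S.

Definition feasible (S : {set V}) : Prop :=
  forall i, (#|S :&: Vs i| <= cap i)%N.

Definition is_optimal (S : {set V}) : Prop :=
  feasible S /\ forall T, feasible T -> f T <= f S.

Definition pm_close (S T : {set V}) : Prop :=
  S \subset T /\ forall i, (#|(T :\: S) :&: Vs i| <= cap i)%N.

(* The guard [0 < g] is the convention 1/0 = +oo: g = 0 is always admissible. *)
Definition pm_dr_bound (g : R) : Prop :=
  forall (S T : {set V}) (e : V), pm_close S T -> e \notin T ->
    0 < g -> marginal e T <= g^-1 * marginal e S.

Definition pm_curvature_bound (a : R) : Prop :=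
  forall (S T : {set V}) (e : V), pm_close S T -> e \notin T ->
    (1 - a) * marginal e S <= marginal e T.

Definition is_pm_dr_ratio (gamma : R) : Prop :=
  [/\ 0 <= gamma <= 1, pm_dr_bound gamma
    & forall g, 0 <= g <= 1 -> pm_dr_bound g -> g <= gamma].

Definition is_pm_curvature (alpha : R) : Prop :=
  [/\ 0 <= alpha <= 1, pm_curvature_bound alpha
    & forall a, 0 <= a <= 1 -> pm_curvature_bound a -> alpha <= a].

End SetFunctions.

Section FastProb.
Context {R : realType} {V : finType} {k : nat}.
Variables (Vs : 'I_k -> {set V}) (cap : 'I_k -> nat) (f : {set V} -> R).
Variables (gamma' alpha' delta : R).

Definition budget : nat := (\sum_(i < k) cap i)%N.
Definition max_part : nat := (\max_(i < k) #|Vs i|)%N.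

(* Control state of the nested loops: [active] is the set I, [cur] is S_t, and
   [queue] lists the indices not yet visited by the current inner pass; when it
   is exhausted the outer loop starts a new pass over I, in increasing order. *)
Record state := State
  { active : {set 'I_k}; queue : seq 'I_k; cur : {set V} }.

Definition init_state : state := State [set: 'I_k] [::] set0.

Definition pending (st : state) : seq 'I_k :=
  if queue st is [::] then enum (active st) else queue st.

Definition next_state (st : state) (e : V) : state :=
  if pending st is i :: q then
    let S' := e |: cur st in
    State (if (cap i <= #|S' :&: Vs i|)%N then active st :\ i else active st)
          q S'
  else st.

(* |R_t|: the real prescribed size is rounded up.  For delta = 0 the logarithm
   is +oo, so the minimum is |V_i \ S|.  The floor at 1 only matters for
   budget = 1 and delta = 1, where the logarithm is 0 and the prescribed sample,
   from which an element has to be chosen, would be empty. *)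
Definition sample_size (i : 'I_k) (S : {set V}) : nat :=
  if delta == 0 then #|Vs i :\: S| else
  minn (maxn 1 `|Num.ceil ((#|Vs i|%:R - #|S :&: Vs i|%:R)
                            / ((cap i)%:R - #|S :&: Vs i|%:R)
                            * ln (budget%:R / delta))|%N)
       #|Vs i :\: S|.

Definition sample_prob (i : 'I_k) (S Rt : {set V}) : R :=
  if (Rt \subset Vs i :\: S) && (#|Rt| == sample_size i S)
  then ('C(#|Vs i :\: S|, sample_size i S))%:R^-1 else 0.

Definition exponent (Rt : {set V}) : nat :=
  `|Num.ceil ((#|Rt|%:R + 1) / (1 - gamma' * (1 - alpha')))|%N.-1.

Definition weight (S Rt : {set V}) (u : V) : R :=
  marginal f u S ^+ exponent Rt.

Definition argmaxs (S Rt : {set V}) : {set V} :=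
  [set e in Rt | [forall u in Rt, marginal f u S <= marginal f e S]].

(* The quotient prescribed for the choice of e_t is meaningless in two cases: an
   infinite exponent (gamma' (1 - alpha') = 1), and vanishing weights (all the
   marginals on Rt are 0).  In both e_t is uniform among the elements of Rt of
   largest marginal, which is the limit for an exponent tending to +oo in the
   first case, and uniform on Rt in the second. *)
Definition select_prob (S Rt : {set V}) (e : V) : R :=
  if (gamma' * (1 - alpha') == 1) || (\sum_(u in Rt) weight S Rt u == 0)
  then (if e \in argmaxs S Rt then #|argmaxs S Rt|%:R^-1 else 0)
  else (if e \in Rt then weight S Rt e / \sum_(u in Rt) weight S Rt u else 0).

(* An iteration is recorded as the pair (R_t, e_t).  The loops perform exactly
   [budget] iterations: the value 0 for a halted state is never used, see
   [traj_prob_sum1] and [run_halts] below. *)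
Definition step_prob (st : state) (x : {set V} * V) : R :=
  if pending st is i :: _ then
    sample_prob i (cur st) x.1 * select_prob (cur st) x.1 x.2
  else 0.

Fixpoint seq_prob (st : state) (s : seq ({set V} * V)) : R :=
  if s is x :: s' then step_prob st x * seq_prob (next_state st x.2) s' else 1.

Definition run (s : seq ({set V} * V)) : state :=
  foldl (fun st x => next_state st x.2) init_state s.

Definition trajectory := budget.-tuple ({set V} * V).

Definition traj_prob (w : trajectory) : R := seq_prob init_state w.

Definition output (w : trajectory) : {set V} := cur (run w).

Definition Pr (G : {set trajectory}) : R := \sum_(w in G) traj_prob w.

Definition cond_expect (G : {set trajectory}) (X : trajectory -> R) : R :=
  (\sum_(w in G) traj_prob w * X w) / Pr G.

(* G only constrains the sampling of the sets R_t: conditionally on G, given the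
   iterations before t and R_t, the element e_t still follows the selection rule
   of the algorithm.  Here w ranges over all possible pasts. *)
Definition sampling_event (G : {set trajectory}) : Prop :=
  forall (t : 'I_budget) (w : trajectory),
    Pr [set w' in G | take t.+1 w' == take t.+1 w]
    = select_prob (cur (run (take t w))) (tnth w t).1 (tnth w t).2
      * Pr [set w' in G | (take t w' == take t w)
                          && ((tnth w' t).1 == (tnth w t).1)].

(* The sets at which f is evaluated to get all the marginals on Rt at S. *)
Definition iter_queries (S Rt : {set V}) : seq {set V} :=
  S :: [seq u |: S | u <- enum Rt].

Definition num_queries (w : trajectory) : nat :=
  (\sum_(t < budget) size (iter_queries (cur (run (take t w))) (tnth w t).1))%N.

End FastProb.

Section Sanity.
Context {R : realType} {V : finType} {k : nat}.
Variables (Vs : 'I_k -> {set V}) (cap : 'I_k -> nat) (f : {set V} -> R).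
Variables (gamma' alpha' delta : R).
Hypothesis Vs_part : is_partition Vs.
Hypothesis cap_le : forall i, (1 <= cap i <= #|Vs i|)%N.

Let inv (st : @state V k) : Prop :=
  [/\ active st = [set i | (#|cur st :&: Vs i| < cap i)%N],
      uniq (queue st), {subset queue st <= active st}
    & forall i, (#|cur st :&: Vs i| <= cap i)%N].

Let left_ (st : @state V k) : nat :=
  (\sum_(i < k) (cap i - #|cur st :&: Vs i|))%N.

Lemma inv_init : inv init_state.
Proof.
split=> //= [|i]; last by rewrite set0I cards0.
by apply/setP => i; rewrite !inE set0I cards0; case/andP: (cap_le i) => ->.
Qed.

Lemma pendingP st : inv st ->
  uniq (pending st) /\ {subset pending st <= active st}.
Proof.
case=> _ u s _; rewrite /pending; case: (queue st) u s => [|//] _ _.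
by split; [exact: enum_uniq | move=> i; rewrite mem_enum].
Qed.

Lemma inv_next st i q e : inv st -> pending st = i :: q ->
  e \in Vs i :\: cur st ->
  inv (next_state Vs cap st e) /\
  left_ st = (left_ (next_state Vs cap st e)).+1.
Proof.
move=> I P /setDP [eV eS]; have [u s] := pendingP I.
rewrite /next_state P; rewrite P in u s.
have [aE _ _ le] := I; have [_ disj _] := Vs_part.
have ia : i \in active st by apply: s; rewrite inE eqxx.
have cj j : j != i -> (e |: cur st) :&: Vs j = cur st :&: Vs j.
  move=> ji; apply/setP => x; rewrite !inE.
  case: (eqVneq x e) => [->|//]; rewrite /= (negPf eS) /=.
  by rewrite (disjointFl (disj _ _ ji) eV).
have ci : #|(e |: cur st) :&: Vs i| = #|cur st :&: Vs i|.+1.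
  have -> : (e |: cur st) :&: Vs i = e |: (cur st :&: Vs i).
    by apply/setP => x; rewrite !inE; case: (eqVneq x e) => [->|//]; rewrite eV.
  by rewrite cardsU1 inE (negPf eS).
have lti : (#|cur st :&: Vs i| < cap i)%N by move: ia; rewrite aE inE.
have aE' : (if (cap i <= #|(e |: cur st) :&: Vs i|)%N then active st :\ i
    else active st) = [set j | (#|(e |: cur st) :&: Vs j| < cap j)%N].
  apply/setP => j; rewrite aE.
  case: (eqVneq j i) => [->|ji].
    by rewrite inE ci; case: leqP; rewrite !inE ?eqxx //= lti.
  by case: ifP => _; rewrite !inE ?ji ?cj.
split.
  split; rewrite //=; first by case/andP: u.
    move=> j jq; rewrite aE' inE.
    have ji : j != i by apply: contraTneq jq => ->; case/andP: u.
    have : j \in active st by apply: s; rewrite inE jq orbT.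
    by rewrite aE inE cj.
  by move=> j; case: (eqVneq j i) => [->|ji]; rewrite ?ci // cj.
rewrite /left_ /= (bigD1 i) //= [in RHS](bigD1 i) //= ci.
under [in RHS]eq_bigr => j ji do rewrite cj //.
by rewrite -addSn -subSn // subSS.
Qed.

Lemma pending_nil st : inv st -> (0 < left_ st)%N -> pending st != [::].
Proof.
case=> aE _ _ _; apply: contraTneq; rewrite /pending.
case: (queue st) => [E|//]; rewrite -eqn0Ngt /left_ sum_nat_eq0.
apply/forallP => i; rewrite /= subn_eq0 leqNgt.
apply/negP => H; have : i \in enum (active st) by rewrite mem_enum aE inE.
by rewrite E.
Qed.

Lemma sample_size_gt0 i S : (#|S :&: Vs i| < cap i)%N ->
  (0 < sample_size Vs cap delta i S)%N.
Proof.
move=> H; have m0 : (0 < #|Vs i :\: S|)%N.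
  rewrite cardsD subn_gt0 setIC; apply: leq_trans H _.
  by case/andP: (cap_le i).
by rewrite /sample_size; case: ifP => // _; rewrite leq_min m0 leq_max.
Qed.

Lemma sample_size_le i S :
  (sample_size Vs cap delta i S <= #|Vs i :\: S|)%N.
Proof. by rewrite /sample_size; case: ifP => // _; rewrite geq_minr. Qed.

Lemma sample_prob_sum1 i S :
  \sum_(Rt : {set V}) sample_prob Vs cap delta i S Rt = 1.
Proof.
rewrite /sample_prob -big_mkcond /= sumr_const.
set m := #|Vs i :\: S|; set r := sample_size _ _ _ _ _.
have -> : #|[pred Rt : {set V} | (Rt \subset Vs i :\: S) && (#|Rt| == r)]|
    = 'C(m, r).
  by rewrite -cards_draws; apply: eq_card => A; rewrite !inE.
rewrite -[LHS]mulr_natr mulVf // pnatr_eq0 -lt0n bin_gt0; exact: sample_size_le.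
Qed.

Lemma select_prob_sum1 S Rt : Rt != set0 ->
  \sum_(e : V) select_prob f gamma' alpha' S Rt e = 1.
Proof.
case/set0Pn => x0 x0R.
have [C|C] := boolP ((gamma' * (1 - alpha') == 1) ||
  (\sum_(u in Rt) weight f gamma' alpha' S Rt u == 0)).
  under eq_bigr do rewrite /select_prob C.
  rewrite -big_mkcond /= sumr_const -[LHS]mulr_natr mulVf // pnatr_eq0 -lt0n.
  apply/card_gt0P.
  case: (@arg_maxP _ _ _ x0 (mem Rt) (fun u => marginal f u S) x0R) => e eR H.
  exists e; rewrite inE; apply/andP; split; first exact: eR.
  by apply/forall_inP => u uR; exact: H.
under eq_bigr do rewrite /select_prob (negPf C).
by case/norP: C => _ nz; rewrite -big_mkcond /= -mulr_suml mulfV.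
Qed.

Lemma step_prob_sum1 st : inv st -> (0 < left_ st)%N ->
  \sum_(x : {set V} * V) step_prob Vs cap f gamma' alpha' delta st x = 1.
Proof.
move=> I L; have := pending_nil I L; rewrite /step_prob.
case P : (pending st) => [//|i q] _.
rewrite -(pair_bigA _ (fun Rt e => sample_prob Vs cap delta i (cur st) Rt *
  select_prob f gamma' alpha' (cur st) Rt e)) /=.
rewrite -[RHS](sample_prob_sum1 i (cur st)); apply: eq_bigr => Rt _.
rewrite -mulr_sumr; case: (eqVneq Rt set0) => [->|nz]; last first.
  by rewrite select_prob_sum1 ?mulr1.
rewrite /sample_prob cards0 ifF ?mul0r //.
apply/negbTE/nandP; right; rewrite eq_sym -lt0n; apply: sample_size_gt0.
have [_ s] := pendingP I; have [aE _ _ _] := I.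
by have := s i; rewrite P inE eqxx aE inE; exact.
Qed.

Lemma step_prob_supp st i q x : pending st = i :: q ->
  step_prob Vs cap f gamma' alpha' delta st x != 0 ->
  [/\ x.1 \subset Vs i :\: cur st,
      #|x.1| = sample_size Vs cap delta i (cur st) & x.2 \in x.1].
Proof.
move=> P; rewrite /step_prob P mulf_eq0 => /norP []; rewrite /sample_prob.
case: ifP => [/andP [-> /eqP ->] _|]; last by rewrite eqxx.
rewrite /select_prob; case: ifP => _; case: ifP; rewrite ?eqxx // => H _.
by split=> //; move: H; rewrite inE => /andP [].
Qed.

Lemma seq_prob_sum1 n st : inv st -> left_ st = n ->
  \sum_(w : n.-tuple ({set V} * V))
    seq_prob Vs cap f gamma' alpha' delta st w = 1.
Proof.
elim: n st => [|n IH] st I L.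
  rewrite (big_pred1 [tuple]) //= => w; apply/esym/eqP; exact: tuple0.
rewrite (reindex (fun p : ({set V} * V) * n.-tuple _ =>
  [tuple of p.1 :: p.2])) /=; last first.
  exists (fun w => (thead w, [tuple of behead w])) => [[x w] _|w _] /=.
    by congr (_, _); apply: val_inj.
  by rewrite [RHS]tuple_eta.
rewrite -(pair_bigA _ (fun x (w : n.-tuple _) =>
  step_prob Vs cap f gamma' alpha' delta st x *
  seq_prob Vs cap f gamma' alpha' delta (next_state Vs cap st x.2) w)) /=.
rewrite -[RHS](step_prob_sum1 I) ?L //; apply: eq_bigr => x _.
rewrite -mulr_sumr.
case: (eqVneq (step_prob Vs cap f gamma' alpha' delta st x) 0) => [->|nz].
  by rewrite mul0r.
have := pending_nil I; rewrite L => /(_ isT).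
case P : (pending st) => [//|i q] _.
have [sub _ xin] := step_prob_supp P nz.
have [I' L'] := inv_next I P (subsetP sub _ xin).
by rewrite IH ?mulr1 //; apply: succn_inj; rewrite -L' L.
Qed.

Lemma left_init : left_ init_state = budget cap.
Proof. by apply: eq_bigr => i _; rewrite set0I cards0 subn0. Qed.

Lemma traj_prob_sum1 :
  \sum_(w : trajectory cap) traj_prob Vs f gamma' alpha' delta w = 1.
Proof. exact: (seq_prob_sum1 inv_init left_init). Qed.

Lemma halts_from n st (w : n.-tuple ({set V} * V)) : inv st -> left_ st = n ->
  seq_prob Vs cap f gamma' alpha' delta st w != 0 ->
  let st' := foldl (fun st x => next_state Vs cap st x.2) st w in
  active st' = set0 /\ forall i, #|cur st' :&: Vs i| = cap i.
Proof.
elim: n st w => [|n IH] st w I L.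
  rewrite (tuple0 w) /= => _; have [aE _ _ le] := I.
  have Z i : (cap i <= #|cur st :&: Vs i|)%N.
    move/eqP: L; rewrite sum_nat_eq0 => /forallP /(_ i) /=.
    by rewrite subn_eq0.
  split; last by move=> i; apply/eqP; rewrite eqn_leq le Z.
  by rewrite aE; apply/setP => i; rewrite !inE ltnNge Z.
case/tupleP: w => x w /=; rewrite mulf_eq0 => /norP [nz].
have := pending_nil I; rewrite L => /(_ isT).
case P : (pending st) => [//|i q] _.
have [sub _ xin] := step_prob_supp P nz.
have [I' L'] := inv_next I P (subsetP sub _ xin).
by apply: IH => //; apply: succn_inj; rewrite -L' L.
Qed.

Lemma run_halts (w : trajectory cap) :
  traj_prob Vs f gamma' alpha' delta w != 0 ->
  active (run Vs cap w) = set0 /\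
  forall i, #|output Vs w :&: Vs i| = cap i.
Proof. exact: (halts_from inv_init left_init). Qed.

End Sanity.

Section Existence.
Context {R : realType} {V : finType} {k : nat}.
Variables (Vs : 'I_k -> {set V}) (cap : 'I_k -> nat) (f : {set V} -> R).
Hypothesis f_mono : monotone f.

Lemma marginal_ge0 e S : 0 <= marginal f e S.
Proof. by rewrite subr_ge0; apply: f_mono; exact: subsetUr. Qed.

Lemma pm_dr_ratio_exists : exists gamma, is_pm_dr_ratio Vs cap f gamma.
Proof.
pose A : classical_sets.set R :=
  fun g => 0 <= g <= 1 /\ pm_dr_bound Vs cap f g.
have A0 : A 0 by split; [rewrite lexx ler01 | move=> ? ? ? _ _; rewrite ltxx].
have An : classical_sets.nonempty A by exists 0.
have Aub : classical_sets.has_ubound A by exists 1 => g [/andP []].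
have s1 : sup A <= 1 by apply: ge_sup => // g [/andP []].
have le g : A g -> g <= sup A by move=> Ag; exact: ub_le_sup.
exists (sup A); split=> [|S T e cl eT s0|g g01 gb].
- by rewrite s1 andbT; exact: le.
- rewrite mulrC ler_pdivlMr // leNgt; apply/negP => lt.
  have T0 : 0 < marginal f e T.
    rewrite lt_neqAle marginal_ge0 andbT eq_sym; apply: contraTneq lt => ->.
    by rewrite mul0r -leNgt marginal_ge0.
  have : sup A <= marginal f e S / marginal f e T.
    apply: ge_sup => // g [/andP [g0 _] gb].
    rewrite ler_pdivlMr //.
    case: (ltgtP g 0) => [|gp|->]; first by rewrite ltNge g0.
      by have := gb _ _ _ cl eT gp; rewrite mulrC ler_pdivlMr // mulrC.
    by rewrite mul0r marginal_ge0.
  by rewrite ler_pdivlMr // mulrC leNgt lt.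
- exact: le.
Qed.

Lemma pm_curvature_exists : exists alpha, is_pm_curvature Vs cap f alpha.
Proof.
pose A : classical_sets.set R :=
  fun a => 0 <= a <= 1 /\ pm_curvature_bound Vs cap f a.
have A1 : A 1.
  split; first by rewrite ler01 lexx.
  by move=> ? ? ? _ _; rewrite subrr mul0r marginal_ge0.
have An : classical_sets.nonempty A by exists 1.
have Alb : classical_sets.has_lbound A by exists 0 => a [/andP []].
have le a : A a -> inf A <= a by move=> Aa; exact: ge_inf.
exists (inf A); split=> [|S T e cl eT|a a01 ab].
- by rewrite le // andbT; apply: lb_le_inf => // a [/andP []].
- have := marginal_ge0 e S; rewrite le_eqVlt => /predU1P [<-|S0].
    by rewrite mulr0 marginal_ge0.
  rewrite -ler_pdivlMr // lerBlDr -lerBlDl.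
  apply: lb_le_inf => // a [_ /(_ _ _ _ cl eT)].
  by rewrite -ler_pdivlMr // lerBlDr -lerBlDl.
- exact: le.
Qed.

End Existence.

(* Main.v *)
Require Import Defs.
From HB Require Import structures.
From mathcomp Require Import all_boot all_order all_algebra.
From mathcomp Require Import reals sequences exp ring lra zify.

Set Implicit Arguments.
Unset Strict Implicit.
Unset Printing Implicit Defensive.

Import Order.TTheory GRing.Theory Num.Theory.
Local Open Scope ring_scope.

(** Fill the optimum up to a set [T] with exactly [cap i] elements in each part, and
    turn [T] into the output one exchange at a time: after t iterations the hybrid
    solution is [S_t :|: O_t].  If the sample [R_t] meets [O_t], let [o] be an element
    of largest marginal in [R_t :&: O_t]; choosing [e] replaces [o] by [e] (or nothing
    changes when [e] is already in [O_t]), and by the two ratios the hybrid loses at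
    most [gamma'^-1 * x_o - (1 - alpha') * x_e], where [x_u] is the marginal of [u] at
    [S_t].  For the power selection rule, weighted AM-GM,
    [(a + 1) x_o x_u^a <= x_o^(a+1) + a x_u^(a+1)], bounds the expected loss by the
    claimed multiple of the expected gain of [f (S_t)].

    The event is that every sample meets [O_t].  The probability of a miss at an
    iteration depends only on the part visited and on how many of its elements are
    already chosen, so the event has an explicit product probability and is
    compatible with the selection rule; the miss probability is at most
    [(1 - q/m)^r <= exp (- q r / m) <= delta / b].  The number of queries is
    controlled by a harmonic sum over each part. *)

(** * Real and combinatorial inequalities: power weights, binomial ratios, harmonic sums *)

Section RealInequalities.
Context {R : realType}.
Implicit Types (x y d eps : R).

(** Induction on [a]: the step adds [y] times the induction hypothesis to the inequality
    [0 <= (x - y) * (x ^+ a.+1 - y ^+ a.+1)], whose two factors have the same sign. *)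
Lemma weighted_amgm_pow x y (a : nat) : 0 <= x -> 0 <= y ->
  (a%:R + 1) * (x * y ^+ a) <= x ^+ a.+1 + a%:R * y ^+ a.+1.
Proof.
move=> x0 y0; elim: a => [|a IH]; first by rewrite expr0 expr1; lra.
have H : 0 <= (x - y) * (x ^+ a.+1 - y ^+ a.+1).
  have [xy|/ltW yx] := lerP x y.
    by rewrite mulr_le0 // subr_le0 // lerXn2r.
  by rewrite mulr_ge0 // subr_ge0 // lerXn2r.
have := ler_wpM2l y0 IH; rewrite -[in _.+1%:R]addn1 natrD.
move: H; rewrite ![_ ^+ a.+2]exprS ![_ ^+ a.+1]exprS.
by move: (x ^+ a) (y ^+ a) (a%:R : R) => u v b; nra.
Qed.

(** Divided by the total weight, this says [x_o (1 - d p_o) <= (1 - d eps) E[x_e]] when [e] is drawn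
    with [p_u] proportional to [x_u ^ a]. AM-GM at each [u] other than [o] costs one [x_o ^ (a+1)];
    these [#|A| - 1] copies are paid for by the slack [d (1 - eps) x_o ^ (a+1)] of the term
    [u = o]. *)
Lemma power_selection_le (V : finType) (A : {set V}) (x : V -> R) (o : V)
    (a : nat) d eps :
  (forall u, 0 <= x u) -> o \in A -> 0 <= eps ->
  d * eps * (a%:R + 1) <= 1 -> #|A|%:R - 1 <= d * (1 - eps) * (a%:R + 1) ->
  x o * (\sum_(u in A) x u ^+ a - d * x o ^+ a)
    <= (1 - d * eps) * \sum_(u in A) x u ^+ a.+1.
Proof.
move=> x0 oA e0 h1 h2.
have a1 : 0 < a%:R + 1 :> R by rewrite ltr_pwDr // ler0n.
(* The first bound on [a] gives [a <= (1 - d eps)(a + 1)], so the AM-GM term [a x_u ^ (a+1)] is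
   absorbed. *)
have term u : (a%:R + 1) * (x o * x u ^+ a - (1 - d * eps) * x u ^+ a.+1)
    <= x o ^+ a.+1.
  have := weighted_amgm_pow a (x0 o) (x0 u).
  have : 0 <= (1 - d * eps * (a%:R + 1)) * x u ^+ a.+1.
    by rewrite mulr_ge0 ?exprn_ge0 // subr_ge0.
  by nra.
have S : (a%:R + 1) * \sum_(u in A :\ o)
    (x o * x u ^+ a - (1 - d * eps) * x u ^+ a.+1)
    <= (#|A|%:R - 1) * x o ^+ a.+1.
  rewrite mulr_sumr (le_trans (ler_sum _ (fun u _ => term u))) //.
  rewrite sumr_const -[X in X <= _]mulr_natl [#|A|](cardsD1 o) oA.
  by rewrite natrD addrAC subrr add0r.
have {S h2} S : \sum_(u in A :\ o)
    (x o * x u ^+ a - (1 - d * eps) * x u ^+ a.+1) <= d * (1 - eps) * x o ^+ a.+1.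
  rewrite -(ler_pM2l a1) (le_trans S) //.
  by rewrite mulrA ler_wpM2r ?exprn_ge0 // mulrC.
rewrite (big_setD1 _ oA) /= [X in _ <= _ * X](big_setD1 _ oA) /=.
move: S; rewrite sumrB -!mulr_sumr exprS; nra.
Qed.

(** The ceiling is positive, so the predecessor is not truncated and [a + 1] is exactly the ceiling
    of [(r + 1) / d]. *)
Lemma ceil_exponent_bounds (r : nat) d : 0 < d ->
  let a := `|Num.ceil ((r%:R + 1) / d)|%N.-1 in
  r%:R + 1 <= d * (a%:R + 1) /\ d * (a%:R + 1) <= r%:R + 1 + d.
Proof.
move=> d0 a; set y := (r%:R + 1) / d.
have y0 : 0 < y by rewrite divr_gt0 // ltr_pwDr.
have c0 : 0 < Num.ceil y by rewrite ceil_gt0.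
have E : a%:R + 1 = (Num.ceil y)%:~R :> R.
  rewrite /a natr1 prednK ?absz_gt0 ?gt_eqF //.
  by rewrite -[in RHS](gtz0_abs c0).
have yE : r%:R + 1 = d * y by rewrite /y mulrC divfK // gt_eqF.
rewrite E yE; split; first by rewrite ler_pM2l // ceil_ge.
have := ceilB1_lt y; rewrite intrD => /ltW.
by rewrite -(ler_pM2l d0); lra.
Qed.

(** Weierstrass product inequality; it plays the part of a union bound over the iterations. *)
Lemma prod_ge_1_sub_sum (I : Type) (s : seq I) (P : pred I) (F G : I -> R) :
  (forall i, P i -> 0 <= F i <= 1) -> (forall i, P i -> 1 - G i <= F i) ->
  1 - \sum_(i <- s | P i) G i <= \prod_(i <- s | P i) F i.
Proof.
move=> F01 GF; elim: s => [|i s IH]; first by rewrite !big_nil subr0.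
have : 0 <= \prod_(j <- s | P j) F j <= 1.
  by rewrite prodr_ge0 ?prodr_ile1 // => j /F01 /andP [].
rewrite !big_cons; case: ifP => // Pi.
have := F01 i Pi; have := GF i Pi; move: IH.
by move: (F i) (G i) (\sum_(j <- s | _) _) (\prod_(j <- s | _) _) => a b c p; nra.
Qed.

Lemma ffact_expn_le (p m r : nat) : (p <= m)%N ->
  (p ^_ r * m ^ r <= m ^_ r * p ^ r)%N.
Proof.
move=> pm; elim: r => [|r IH]; first by rewrite !ffactn0 !expn0.
rewrite !ffactnSr !expnSr mulnACA [leqRHS]mulnACA leq_mul //.
by rewrite !mulnBl [(m * p)%N]mulnC leq_sub2l // leq_mul2l pm orbT.
Qed.

(** Drawing [r] elements without replacement stays inside a given set of [p] elements no more often
    than drawing with replacement, since each factor satisfies [(p - j) / (m - j) <= p / m]. *)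
Lemma bin_ratio_le (p m r : nat) : (p <= m)%N -> (0 < m)%N -> (r <= m)%N ->
  'C(p, r)%:R / 'C(m, r)%:R <= (p%:R / m%:R) ^+ r :> R.
Proof.
move=> pm m0 rm; have c0 : 0 < 'C(m, r)%:R :> R by rewrite ltr0n bin_gt0.
have X0 : 0 < m%:R ^+ r :> R by rewrite exprn_gt0 ?ltr0n.
rewrite expr_div_n ler_pdivlMr // mulrAC ler_pdivrMr // -!natrX -!natrM ler_nat.
rewrite -(leq_pmul2l (fact_gt0 r)) mulnA [(r`! * _)%N]mulnC bin_ffact.
have -> : (r`! * (p ^ r * 'C(m, r)) = m ^_ r * p ^ r)%N.
  by rewrite -bin_ffact; lia.
exact: ffact_expn_le.
Qed.

Lemma harmonic_le_ln (n : nat) : (0 < n)%N ->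
  \sum_(0 <= j < n) j.+1%:R^-1 <= 1 + ln n%:R :> R.
Proof.
case: n => // n _; elim: n => [|n IH]; first by rewrite big_nat1 invr1 ln1 addr0.
rewrite big_nat_recr //= -lerBrDr (le_trans IH) // -addrA lerD2l.
have n1 : 0 < n.+1%:R :> R by rewrite ltr0n.
have n2 : 0 < n.+2%:R :> R by rewrite ltr0n.
have E : n.+1%:R / n.+2%:R = 1 + - n.+2%:R^-1 :> R.
  move: n2; rewrite -[n.+2%:R]natr1; move: (n.+1%:R : R) => z z1.
  by field; rewrite gt_eqF.
(* Here [ln (1 + x) <= x] bounds the new term [1 / (n + 2)] by [ln (n + 2) - ln (n + 1)]. *)
have := @le_ln1Dx R (- n.+2%:R^-1).
rewrite -E ltrN2 invf_lt1 // ltr1n => /(_ isT).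
by rewrite ln_div ?posrE // lerBlDl.
Qed.

End RealInequalities.

Lemma big_tuple_cons (R : nmodType) (A : finType) (n : nat)
    (P : pred (n.+1.-tuple A)) (F : n.+1.-tuple A -> R) :
  \sum_(w | P w) F w =
  \sum_(x : A) \sum_(w : n.-tuple A | P [tuple of x :: w]) F [tuple of x :: w].
Proof.
rewrite pair_big_dep /= (reindex (fun p : A * n.-tuple A =>
  [tuple of p.1 :: p.2])) //=.
exists (fun w => (thead w, [tuple of behead w])) => [[x w] _|w _] /=.
  by congr (_, _); apply: val_inj.
by rewrite [RHS]tuple_eta.
Qed.

(** * Loop invariants, hybrid solutions and the hitting event *)

Section HybridAnalysis.
Context {R : realType} {V : finType} {k : nat}.
Variables (Vs : 'I_k -> {set V}) (cap : 'I_k -> nat) (f : {set V} -> R).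
Variables (gamma' alpha' delta : R).
Hypothesis Vs_part : is_partition Vs.
Hypothesis cap_le : forall i, (1 <= cap i <= #|Vs i|)%N.

Local Notation sample := (sample_prob Vs cap delta).
Local Notation select := (select_prob f gamma' alpha').
Local Notation step := (step_prob Vs cap f gamma' alpha' delta).
Local Notation path_prob := (seq_prob Vs cap f gamma' alpha' delta).
Local Notation next := (next_state Vs cap).
Implicit Types (st : @state V k) (S O Rt : {set V}) (e o : V) (i j : 'I_k).

(** Convertible to the section-local invariant of [inv_next] and [pendingP], so that these lemmas
    apply directly. *)
Definition loop_inv st : Prop :=
  [/\ active st = [set i | (#|cur st :&: Vs i| < cap i)%N],
      uniq (queue st), {subset queue st <= active st}
    & forall i, (#|cur st :&: Vs i| <= cap i)%N].

Definition steps_left st : nat :=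
  (\sum_(i < k) (cap i - #|cur st :&: Vs i|))%N.

(* [O] is the part of the hybrid solution [cur st :|: O] still to be exchanged. *)
Definition hybrid_inv st O : Prop :=
  [/\ loop_inv st, [disjoint O & cur st]
    & forall i, (#|O :&: Vs i| + #|cur st :&: Vs i| = cap i)%N].

(** The default [e] of [odflt] is reached only when [Rt] misses [O], which [hits] excludes. *)
Definition exchange S O Rt e : V :=
  if e \in O then e else odflt e [pick o in argmaxs f S (Rt :&: O)].

Fixpoint hits st O (s : seq ({set V} * V)) : bool :=
  if s is x :: s' then
    (x.1 :&: O != set0) &&
    hits (next st x.2) (O :\ exchange (cur st) O x.1 x.2) s'
  else true.

(** The sample size as a function of the count [s] alone, which makes hit probabilities and query
    counts independent of the history. *)
Definition draw_size i (s : nat) : nat :=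
  if delta == 0 then (#|Vs i| - s)%N else
  minn (maxn 1 `|Num.ceil ((#|Vs i|%:R - s%:R) / ((cap i)%:R - s%:R)
                            * ln ((budget cap)%:R / delta))|%N)
       (#|Vs i| - s)%N.

(** Complement of a hypergeometric miss: of the [#|Vs i| - s] available elements, [cap i - s] lie in
    [O] and [#|Vs i| - cap i] do not. *)
Definition hit_prob i (s : nat) : R :=
  1 - 'C(#|Vs i| - cap i, draw_size i s)%:R / 'C(#|Vs i| - s, draw_size i s)%:R.

(** The remaining iterations are indexed by pairs (part, current count) rather than by time:
    whatever the choices, each such pair occurs exactly once. *)
Definition all_hit_prob S : R :=
  \prod_i \prod_(#|S :&: Vs i| <= s < cap i) hit_prob i s.

Lemma sample_sizeE i S :
  sample_size Vs cap delta i S = draw_size i #|S :&: Vs i|.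
Proof. by rewrite /sample_size /draw_size cardsD [Vs i :&: S]setIC. Qed.

Lemma card_part_setU1 S i j e : e \in Vs i :\: S ->
  #|(e |: S) :&: Vs j| = ((j == i) + #|S :&: Vs j|)%N.
Proof.
move=> /setDP [eV eS]; have [_ disj _] := Vs_part; case: eqVneq => [->|ji].
  have -> : (e |: S) :&: Vs i = e |: (S :&: Vs i).
    by apply/setP => x; rewrite !inE; case: (eqVneq x e) => [->|//]; rewrite eV.
  by rewrite cardsU1 inE (negPf eS).
apply: eq_card => x; rewrite !inE.
case: (eqVneq x e) => [->|//]; rewrite /= (negPf eS) /=.
by rewrite (disjointFl (disj _ _ ji) eV).
Qed.

(** Take a feasible superset of maximal cardinality: an unfilled part would still have a free
    element, because [cap i <= #|Vs i|]. *)
Lemma feasible_extend S : feasible Vs cap S ->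
  exists2 T : {set V}, S \subset T & forall i, #|T :&: Vs i| = cap i.
Proof.
move=> fS; pose P (T : {set V}) :=
  (S \subset T) && [forall i, #|T :&: Vs i| <= cap i]%N.
have PS : P S by rewrite /P subxx; apply/forallP.
case: (arg_maxnP (fun T : {set V} => #|T|) PS) => T /andP [ST /forallP fT] Tmax.
exists T => // i; apply/eqP; rewrite eqn_leq fT leqNgt; apply/negP => lti.
have /set0Pn [e eT] : Vs i :\: T != set0.
  rewrite -card_gt0 cardsD subn_gt0 setIC (leq_trans lti) //.
  by case/andP: (cap_le i).
have : P (e |: T).
  rewrite /P (subset_trans ST) ?subsetUr //; apply/forallP => j.
  by rewrite (card_part_setU1 _ eT); case: eqVneq => [->|_]; last exact: fT.
by move/Tmax => /=; rewrite cardsU1; case/setDP: eT => _ ->; rewrite ltnn.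
Qed.

(** Stated for an arbitrary commutative law since it serves both the product of hit probabilities
    and the sum of queries. *)
Lemma big_fill_next (T : Type) (idx : T) (op : Monoid.com_law idx)
    (F : 'I_k -> nat -> T) S i e :
  e \in Vs i :\: S -> (#|S :&: Vs i| < cap i)%N ->
  \big[op/idx]_j \big[op/idx]_(#|S :&: Vs j| <= s < cap j) F j s =
  op (F i #|S :&: Vs i|)
     (\big[op/idx]_j \big[op/idx]_(#|(e |: S) :&: Vs j| <= s < cap j) F j s).
Proof.
move=> eS lti; rewrite (bigD1 i) //= [in RHS](bigD1 i) //=.
rewrite big_ltn // (card_part_setU1 _ eS) eqxx add1n.
rewrite -[LHS](Monoid.mulmA op); do 2!congr (op _ _).
apply: eq_bigr => j ji.
by rewrite (card_part_setU1 _ eS) (negPf ji).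
Qed.

Lemma pending_cons st n : loop_inv st -> steps_left st = n.+1 ->
  exists i q, pending st = i :: q /\ (#|cur st :&: Vs i| < cap i)%N.
Proof.
move=> I L; have := pending_nil I; rewrite -/(steps_left st) L => /(_ isT).
have [_ sub] := pendingP I; have [aE _ _ _] := I.
case P : (pending st) => [//|i q] _; exists i, q; split=> //.
by have := sub i; rewrite P inE eqxx aE inE; exact.
Qed.

Lemma cur_next st i q e : pending st = i :: q -> cur (next st e) = e |: cur st.
Proof. by rewrite /next_state => ->. Qed.

Lemma argmaxs_neq0 S Rt : Rt != set0 -> argmaxs f S Rt != set0.
Proof.
case/set0Pn => x xR; apply/set0Pn.
case: (@arg_maxP _ _ _ x (mem Rt) (fun u => marginal f u S) xR) => e eR H.
by exists e; rewrite inE; apply/andP; split=> //; apply/forall_inP.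
Qed.

Lemma exchange_in S O Rt e : Rt :&: O != set0 -> e \in Rt ->
  exchange S O Rt e \in Rt :&: O.
Proof.
move=> h eR; rewrite /exchange; case: ifP => [eO|_]; first by rewrite inE eR.
case: pickP => [o|none]; first by rewrite inE => /andP [].
by case/set0Pn: (argmaxs_neq0 S h) => o; rewrite none.
Qed.

(** The chosen and the exchanged elements both lie in the visited part [Vs i], so the count in each
    part stays balanced. *)
Lemma hybrid_inv_next st O i q Rt e :
  hybrid_inv st O -> pending st = i :: q -> Rt \subset Vs i :\: cur st ->
  Rt :&: O != set0 -> e \in Rt ->
  hybrid_inv (next st e) (O :\ exchange (cur st) O Rt e).
Proof.
move=> [I dis tot] P sub h eR; have eS := subsetP sub _ eR.
have := exchange_in (cur st) h eR; set o := exchange _ _ _ _ => /setIP [oR oO].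
have /setDP [oV _] := subsetP sub _ oR.
have [I' _] := inv_next Vs_part I P eS.
split=> //; rewrite (cur_next _ P).
  rewrite -setI_eq0; apply/eqP/setP => x; rewrite !inE.
  case: (eqVneq x e) => [->|_] /=.
    rewrite andbT; apply/negP => /andP [].
    by rewrite /o /exchange => + eO; rewrite eO eqxx.
  apply/negP => /andP [/andP [_ xO] xS].
  by rewrite (disjointFr dis xO) in xS.
move=> j; rewrite (card_part_setU1 _ eS) -tot addnA; congr (_ + _)%N.
case: eqVneq => [->|ji].
  by rewrite setIDAC [RHS](cardsD1 o) inE oO oV addn1 add1n.
rewrite addn0; apply: eq_card => x; rewrite !inE.
case: (eqVneq x o) => [->|//]; have [_ disj _] := Vs_part.
by rewrite (disjointFl (disj _ _ ji) oV) !andbF.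
Qed.

Lemma draw_size_gt0 i s : (s < cap i)%N -> (0 < draw_size i s)%N.
Proof.
move=> lts; have m0 : (0 < #|Vs i| - s)%N.
  by rewrite subn_gt0 (leq_trans lts) //; case/andP: (cap_le i).
by rewrite /draw_size; case: ifP => // _; rewrite leq_min m0 leq_max.
Qed.

Lemma draw_size_le i s : (draw_size i s <= #|Vs i| - s)%N.
Proof. by rewrite /draw_size; case: ifP => // _; rewrite geq_minr. Qed.

(** At least one available element lies in [O] and the sample is nonempty; Pascal's rule then makes
    the binomial comparison strict. This allows division by [hit_prob]. *)
Lemma hit_prob_gt0 i s : (s < cap i)%N -> 0 < hit_prob i s.
Proof.
move=> lts; rewrite subr_gt0 ltr_pdivrMr; last first.
  by rewrite ltr0n bin_gt0 draw_size_le.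
rewrite mul1r ltr_nat; have := draw_size_gt0 lts; have := draw_size_le i s.
case: (draw_size i s) => // r le _.
have [_ cV] := andP (cap_le i).
have -> : (#|Vs i| - s = (#|Vs i| - s).-1.+1)%N by lia.
rewrite binS -[ltnLHS]addn0 -addnS leq_add // ?bin_gt0; last by lia.
by apply: leq_bin2l; lia.
Qed.

Lemma hit_prob_le1 i s : hit_prob i s <= 1.
Proof. by rewrite lerBlDr lerDl divr_ge0. Qed.

(** The missing samples are the draws from [(Vs i :\: cur st) :\: O], whose size is
    [#|Vs i| - cap i] by the balance in [hybrid_inv]; the result thus does not depend on [O]. *)
Lemma sum_sample_hit st O i : hybrid_inv st O ->
  \sum_(Rt | Rt :&: O != set0) sample i (cur st) Rt
    = hit_prob i #|cur st :&: Vs i|.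
Proof.
move=> [_ dis tot]; apply/eqP; rewrite /hit_prob eq_sym subr_eq.
rewrite -[X in X == _](sample_prob_sum1 Vs cap delta i (cur st)).
rewrite (bigID (fun Rt : {set V} => Rt :&: O != set0)) /=; apply/eqP; congr (_ + _).
rewrite /sample_prob -big_mkcondr /= sumr_const -[LHS]mulr_natl sample_sizeE.
have cS : #|Vs i :\: cur st| = (#|Vs i| - #|cur st :&: Vs i|)%N.
  by rewrite cardsD [Vs i :&: _]setIC.
rewrite cS; congr (_%:R * _).
have -> : (#|Vs i| - cap i)%N = #|(Vs i :\: cur st) :\: O|.
  rewrite cardsD cS -subnDA -tot addnC; congr (_ - (_ + _))%N.
  apply: eq_card => x; rewrite !inE andbC; case: (boolP (x \in O)) => [xO|_].
    by rewrite (disjointFr dis xO).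
  by rewrite !andbF.
rewrite -cards_draws; apply: eq_card => A; rewrite [RHS]inE unfold_in negbK.
by rewrite [A \subset _ :\: O]subsetD -setI_eq0 [in RHS]andbAC andbC.
Qed.

Lemma sum_step_hit st O i q (F : {set V} * V -> R) : pending st = i :: q ->
  \sum_(x | x.1 :&: O != set0) step st x * F x =
  \sum_(Rt | Rt :&: O != set0)
    sample i (cur st) Rt * \sum_e select (cur st) Rt e * F (Rt, e).
Proof.
move=> P; under [RHS]eq_bigr => Rt _ do rewrite mulr_sumr.
rewrite pair_big /=; apply: eq_big => [[Rt e]|[Rt e] _] /=; first by rewrite andbT.
by rewrite /step_prob P mulrA.
Qed.

Lemma sum_hits_cons n st O (X : seq ({set V} * V) -> R) :
  \sum_(w : n.+1.-tuple ({set V} * V) | hits st O w) path_prob st w * X w =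
  \sum_(x | x.1 :&: O != set0) step st x *
    \sum_(w : n.-tuple ({set V} * V)
      | hits (next st x.2) (O :\ exchange (cur st) O x.1 x.2) w)
      path_prob (next st x.2) w * X (x :: w).
Proof.
rewrite big_tuple_cons [RHS]big_mkcond; apply: eq_bigr => x _ /=.
case: ifP => _ /=; last by rewrite big_pred0.
by rewrite mulr_sumr; apply: eq_bigr => w _; rewrite mulrA.
Qed.

Lemma step_hit_next st O i q n x : hybrid_inv st O -> pending st = i :: q ->
  steps_left st = n.+1 -> x.1 :&: O != set0 -> step st x != 0 ->
  [/\ x.1 \subset Vs i :\: cur st, x.2 \in x.1,
      hybrid_inv (next st x.2) (O :\ exchange (cur st) O x.1 x.2)
    & steps_left (next st x.2) = n].
Proof.
move=> I P L h nz; have [sub _ xin] := step_prob_supp P nz.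
have [I0 _ _] := I; have [_ L'] := inv_next Vs_part I0 P (subsetP sub _ xin).
split=> //; first exact: hybrid_inv_next P sub h xin.
by apply: succn_inj; rewrite -L -L'.
Qed.

Lemma steps_left0 st : loop_inv st -> steps_left st = 0%N ->
  forall i, #|cur st :&: Vs i| = cap i.
Proof.
move=> [_ _ _ le] /eqP; rewrite sum_nat_eq0 => /forallP L i.
by apply/eqP; rewrite eqn_leq le -subn_eq0; exact: L.
Qed.

Lemma all_hit_prob_next S i e : e \in Vs i :\: S -> (#|S :&: Vs i| < cap i)%N ->
  all_hit_prob (e |: S) = all_hit_prob S / hit_prob i #|S :&: Vs i|.
Proof.
move=> eS lti; rewrite /all_hit_prob (big_fill_next _ hit_prob eS lti) /=.
by rewrite mulrAC divff ?mul1r // gt_eqF // hit_prob_gt0.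
Qed.

(** By induction the later iterations contribute the same constant [c] for every outcome of the
    current one; the selection law then sums to 1 and the sampling law leaves [hit_prob]. *)
Lemma sum_hits n st O : hybrid_inv st O -> steps_left st = n ->
  \sum_(w : n.-tuple ({set V} * V) | hits st O w) path_prob st w
    = all_hit_prob (cur st).
Proof.
elim: n st O => [|n IH] st O I L.
  rewrite (big_pred1 [tuple]) /= => [|w]; last first.
    by rewrite (tuple0 w) /= eqxx.
  have [I0 _ _] := I; rewrite /all_hit_prob big1 // => i _.
  by rewrite big_geq // (steps_left0 I0 L).
have [I0 _ _] := I; have [i [q [P lti]]] := pending_cons I0 L.
under eq_bigr do rewrite -[path_prob _ _]mulr1.
rewrite (sum_hits_cons _ _ _ (fun=> 1)).
pose c := all_hit_prob (cur st) / hit_prob i #|cur st :&: Vs i|.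
transitivity (\sum_(x | x.1 :&: O != set0) step st x * c).
  apply: eq_bigr => x h; have [->|nz] := eqVneq (step st x) 0.
    by rewrite !mul0r.
  have [sub xin I' L'] := step_hit_next I P L h nz.
  under eq_bigr do rewrite mulr1.
  rewrite (IH _ _ I' L') (cur_next _ P).
  by rewrite (all_hit_prob_next (subsetP sub _ xin) lti).
rewrite (sum_step_hit _ (fun=> c) P).
under eq_bigr => Rt h.
  have Rn : Rt != set0 by apply: contraNneq h => ->; rewrite set0I.
  rewrite -mulr_suml select_prob_sum1 // mul1r; over.
rewrite -mulr_suml sum_sample_hit // /c mulrCA divff ?mulr1 //.
by rewrite gt_eqF // hit_prob_gt0.
Qed.

Lemma step_sum_hits n st O i q x : hybrid_inv st O -> steps_left st = n.+1 ->
  pending st = i :: q -> (#|cur st :&: Vs i| < cap i)%N -> x.1 :&: O != set0 ->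
  step st x * \sum_(w : n.-tuple ({set V} * V)
      | hits (next st x.2) (O :\ exchange (cur st) O x.1 x.2) w)
      path_prob (next st x.2) w =
  step st x * (all_hit_prob (cur st) / hit_prob i #|cur st :&: Vs i|).
Proof.
move=> I L P lti h; have [->|nz] := eqVneq (step st x) 0; first by rewrite !mul0r.
have [sub xin I' L'] := step_hit_next I P L h nz.
by rewrite sum_hits // (cur_next _ P) (all_hit_prob_next (subsetP sub _ xin) lti).
Qed.

(* The probability of hitting at all later steps does not depend on the choice of
   e_t, hence conditioning on it leaves the law of e_t unchanged. *)
Lemma hits_select x0 (t n : nat) st O (w : n.-tuple ({set V} * V)) :
  hybrid_inv st O -> steps_left st = n -> (t < n)%N ->
  \sum_(w' : n.-tuple ({set V} * V)
    | hits st O w' && (take t.+1 w' == take t.+1 w)) path_prob st w' =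
  select (cur (foldl (fun st x => next st x.2) st (take t w)))
    (nth x0 w t).1 (nth x0 w t).2 *
  \sum_(w' : n.-tuple ({set V} * V)
    | hits st O w' && ((take t w' == take t w)
                       && ((nth x0 w' t).1 == (nth x0 w t).1))) path_prob st w'.
Proof.
elim: t n st O w => [|t IH] [//|n] st O; case/tupleP => y w I L tn.
  have [I0 _ _] := I; have [i [q [P lti]]] := pending_cons I0 L.
  rewrite !big_tuple_cons /= !take0 /=.
  pose c := all_hit_prob (cur st) / hit_prob i #|cur st :&: Vs i|.
  (* [F x] is the total mass of the hitting trajectories whose first iteration is [x]. *)
  pose F x : R := if x.1 :&: O != set0 then step st x * c else 0.
  have FE x : \sum_(w' : n.-tuple ({set V} * V) | (x.1 :&: O != set0) &&
      hits (next st x.2) (O :\ exchange (cur st) O x.1 x.2) w')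
      step st x * path_prob (next st x.2) w' = F x.
    rewrite /F; case: ifP => [h|_] /=; last by rewrite big_pred0.
    by rewrite -mulr_sumr (step_sum_hits I L P lti h).
  transitivity (F y).
    rewrite (bigD1 y) //= [X in _ + X]big1 ?addr0 => [|x /negPf xy].
      by rewrite -FE; apply: eq_bigl => w'; rewrite take0 eqxx andbT.
    by rewrite big_pred0 // => w'; rewrite take0 eqseq_cons xy andbF.
  transitivity (select (cur st) y.1 y.2 * \sum_e F (y.1, e)); last first.
    congr (_ * _); symmetry.
    rewrite (eq_bigr (fun x => if x.1 == y.1 then F (x.1, x.2) else 0)); last first.
      case=> Rt e _ /=; case: (Rt == y.1); last first.
        by rewrite big_pred0 // => w'; rewrite !andbF.
      by rewrite -FE; apply: eq_bigl => w'; rewrite ?take0 ?eqxx ?andbT.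
    rewrite -(pair_bigA _ (fun Rt e => if Rt == y.1 then F (Rt, e) else 0)) /=.
    rewrite (bigD1 y.1) //= [X in _ + X]big1 ?addr0 => [|Rt /negPf ny].
      by apply: eq_bigr => e _; rewrite eqxx.
    by rewrite big1 // => e _; rewrite ny.
  rewrite /F /=; case: ifP => [h|_]; last by rewrite big1 ?mulr0.
  have yn : y.1 != set0 by apply: contraNneq h => ->; rewrite set0I.
  rewrite -mulr_suml /step_prob P /= -mulr_sumr select_prob_sum1 // mulr1.
  by rewrite mulrA [select _ _ _ * _]mulrC.
rewrite ltnS in tn; rewrite !big_tuple_cons /=.
(* Both sides fix the first iteration to [y]; [r] is the prefix map on the tail and [Q] the
   remaining condition, so one statement factors [step st y] out of both. *)
have head_sum (Q : pred (seq ({set V} * V)))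
    (r : seq ({set V} * V) -> seq ({set V} * V)) s :
    \sum_x \sum_(w' : n.-tuple ({set V} * V) | (x.1 :&: O != set0) &&
      hits (next st x.2) (O :\ exchange (cur st) O x.1 x.2) w' &&
      ((x :: r w' == y :: s) && Q w')) step st x * path_prob (next st x.2) w' =
    (y.1 :&: O != set0)%:R * (step st y * \sum_(w' : n.-tuple ({set V} * V) |
      hits (next st y.2) (O :\ exchange (cur st) O y.1 y.2) w' &&
      ((r w' == s) && Q w')) path_prob (next st y.2) w').
  rewrite (bigD1 y) //= [X in _ + X]big1 ?addr0 => [|x /negPf xy].
    case: (y.1 :&: O != set0); rewrite ?mul0r ?mul1r /=; last by rewrite big_pred0.
    rewrite mulr_sumr; apply: eq_bigl => w'.
    by rewrite eqseq_cons eqxx.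
  by rewrite big_pred0 // => w'; rewrite eqseq_cons xy andbF.
rewrite (head_sum (fun w' => (nth x0 w' t).1 == (nth x0 w t).1) (take t)).
under eq_bigr do under eq_bigl do rewrite -[(_ :: _ == _)]andbT.
rewrite (head_sum predT (take t.+1)) /= !mulrA [_ * (_ != _)%:R]mulrC -!mulrA.
have [h|_] := boolP (y.1 :&: O != set0); last by rewrite !mul0r.
congr (_ * _); rewrite mulrCA.
have [->|nz] := eqVneq (step st y) 0; first by rewrite !mul0r.
have [I0 _ _] := I; have [i [q [P lti]]] := pending_cons I0 L.
have [sub yin I' L'] := step_hit_next I P L h nz.
by congr (_ * _); rewrite -IH //; apply: eq_bigl => w'; rewrite andbT.
Qed.

(** * Lower bounds for the probability of the hitting event *)

Lemma hit_prob_ge i s : (s < cap i)%N -> 0 <= delta -> delta <= 1 ->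
  1 - delta / (budget cap)%:R <= hit_prob i s.
Proof.
move=> lts d0 d1; have /andP [_ cV] := cap_le i.
have b0 : 0 < (budget cap)%:R :> R.
  rewrite ltr0n /budget (bigD1 i) //=; case/andP: (cap_le i); lia.
rewrite lerD2l lerN2.
(* If the whole remainder of the part is drawn, a miss is impossible: the binomial coefficient in
   the numerator vanishes. *)
have full : draw_size i s = (#|Vs i| - s)%N ->
    'C(#|Vs i| - cap i, draw_size i s)%:R / 'C(#|Vs i| - s, draw_size i s)%:R
      <= delta / (budget cap)%:R :> R.
  move=> ->; rewrite [X in X%:R / _]bin_small; last by lia.
  by rewrite mul0r divr_ge0 // ltW.
have [dz|dn] := eqVneq delta 0; first by apply: full; rewrite /draw_size dz eqxx.
have [le|lt] := leqP (#|Vs i| - s) (maxn 1 `|Num.ceil ((#|Vs i|%:R - s%:R)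
    / ((cap i)%:R - s%:R) * ln ((budget cap)%:R / delta))|%N).
  by apply: full; rewrite /draw_size (negPf dn); apply/minn_idPr.
have dp : 0 < delta by rewrite lt_neqAle eq_sym dn.
have m0 : (0 < #|Vs i| - s)%N by lia.
apply: le_trans (bin_ratio_le _ _ (draw_size_le i s)) _ => //; first by lia.
have rE : draw_size i s = maxn 1 `|Num.ceil ((#|Vs i|%:R - s%:R)
    / ((cap i)%:R - s%:R) * ln ((budget cap)%:R / delta))|%N.
  by rewrite /draw_size (negPf dn); apply/minn_idPl/ltnW.
set m : R := #|Vs i|%:R - s%:R; set q : R := (cap i)%:R - s%:R.
have q0 : 0 < q by rewrite subr_gt0 ltr_nat.
have qm : q <= m by rewrite lerD2r ler_nat.
have mp : 0 < m by apply: lt_le_trans qm.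
have ratioE : (#|Vs i| - cap i)%:R / (#|Vs i| - s)%:R = 1 - q / m :> R.
  rewrite !natrB // ?(ltnW (leq_trans lts cV)) // -/m.
  have -> : #|Vs i|%:R - (cap i)%:R = m - q by rewrite /m /q; ring.
  by rewrite mulrBl divff // gt_eqF.
rewrite ratioE; set r := draw_size i s in rE *.
(* The ceiling, the absolute value and the floor at 1 can only enlarge the prescribed size. *)
have rge : m / q * ln ((budget cap)%:R / delta) <= r%:R.
  apply: le_trans (ceil_ge _) _; rewrite rE.
  apply: (@le_trans _ _ (`|Num.ceil (m / q * ln ((budget cap)%:R / delta))|%N)%:R).
    by rewrite natr_absz ler_int ler_norm.
  by rewrite ler_nat leq_maxr.
have E1 : (1 - q / m) ^+ r <= expR (- (q / m)) ^+ r.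
  by rewrite lerXn2r ?nnegrE ?expR_ge0 ?expR_ge1Dx // subr_ge0 ler_pdivrMr ?mul1r.
apply: (le_trans E1); rewrite -expRM_natr.
have -> : delta / (budget cap)%:R = expR (- ln ((budget cap)%:R / delta)).
  by rewrite -lnV ?posrE ?divr_gt0 // invf_div lnK // posrE divr_gt0.
rewrite ler_expR mulNr lerN2.
have -> : ln ((budget cap)%:R / delta) = q / m * (m / q * ln ((budget cap)%:R / delta)).
  by rewrite mulrA [q / m * _]mulrA divfK ?divff ?mul1r // gt_eqF.
by rewrite ler_wpM2l // divr_ge0 // ltW.
Qed.

Lemma all_hit_prob_gt0 S : 0 < all_hit_prob S.
Proof.
apply: prodr_gt0 => i _; rewrite big_nat_cond; apply: prodr_gt0 => s.
by case/andP=> /andP [_ lts] _; exact: hit_prob_gt0.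
Qed.

(** The product inequality is used twice: part [i] loses at most [cap i * delta / b], and over all
    parts these losses sum to [delta]. *)
Lemma all_hit_prob0_ge : (0 < budget cap)%N -> 0 <= delta -> delta <= 1 ->
  1 - delta <= all_hit_prob set0.
Proof.
move=> b0 d0 d1; rewrite /all_hit_prob.
have hit01 i s : (s < cap i)%N -> 0 <= hit_prob i s <= 1.
  by move=> lts; rewrite hit_prob_le1 ltW // hit_prob_gt0.
have sumE : \sum_(i < k) (cap i)%:R * (delta / (budget cap)%:R) = delta.
  by rewrite -mulr_suml -natr_sum mulrC divfK // pnatr_eq0 -lt0n.
rewrite -[X in 1 - X]sumE; apply: prod_ge_1_sub_sum => i _.
  rewrite big_nat_cond; apply/andP; split.
    apply: prodr_ge0 => s /andP [/andP [_ lts] _].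
    by case/andP: (hit01 _ _ lts).
  apply: prodr_ile1 => s /andP [/andP [_ lts] _].
  exact: hit01.
rewrite set0I cards0 big_nat_cond.
have -> : (cap i)%:R * (delta / (budget cap)%:R) =
    \sum_(s <- index_iota 0 (cap i) | (0 <= s < cap i)%N && true)
       delta / (budget cap)%:R.
  by rewrite -big_nat_cond sumr_const_nat subn0 mulr_natl.
by apply: prod_ge_1_sub_sum => s /andP [lts _]; [exact: hit01 | exact: hit_prob_ge].
Qed.

(** * Number of queries, which is the same on every run of positive probability *)

Lemma queries_from x0 n st (w : n.-tuple ({set V} * V)) :
  loop_inv st -> steps_left st = n -> path_prob st w != 0 ->
  (\sum_(t < n) size (iter_queries
     (cur (foldl (fun st x => next st x.2) st (take t w))) (nth x0 w t).1) =
   \sum_i \sum_(#|cur st :&: Vs i| <= s < cap i) (draw_size i s).+1)%N.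
Proof.
elim: n st w => [|n IH] st w I L.
  move=> _; rewrite big_ord0 big1 // => i _.
  by rewrite big_geq // (steps_left0 I L).
case/tupleP: w => x w /=; rewrite mulf_eq0 => /norP [nz nz'].
have [i [q [P lti]]] := pending_cons I L.
have [sub sz xin] := step_prob_supp P nz.
have [I' L'] := inv_next Vs_part I P (subsetP sub _ xin).
rewrite big_ord_recl /= size_map -cardE sz sample_sizeE.
rewrite (big_fill_next _ _ (subsetP sub _ xin) lti) /=; congr (_ + _)%N.
rewrite -(cur_next _ P) -(IH _ w) //.
by apply: succn_inj; rewrite -L; symmetry.
Qed.

Lemma draw_size_ub i s : (s < cap i)%N -> 0 < delta -> delta <= 1 ->
  (1 < budget cap)%N ->
  (draw_size i s).+1%:R <=
    3 + #|Vs i|%:R * ln ((budget cap)%:R / delta) * (cap i - s)%:R^-1 :> R.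
Proof.
move=> lts d0 d1 b1; have /andP [_ cV] := cap_le i.
have b1' : 1 <= (budget cap)%:R / delta :> R.
  rewrite ler_pdivlMr // mul1r (le_trans d1) // ler1n; exact: ltnW.
have L0 := ln_ge0 b1'; set L := ln _ in L0 *.
have q0 : 0 < (cap i - s)%:R :> R by rewrite ltr0n subn_gt0.
rewrite /draw_size gt_eqF //; set y := _ / _ * L.
have y0 : 0 <= y.
  by rewrite mulr_ge0 // divr_ge0 // subr_ge0 ler_nat ltnW // (leq_trans lts).
have yle : y <= #|Vs i|%:R * L * (cap i - s)%:R^-1.
  rewrite /y -[(cap i)%:R - _]natrB 1?ltnW // -!mulrA [_^-1 * L]mulrC.
  rewrite ler_wpM2r ?gerBl //; by rewrite mulr_ge0 // invr_ge0.
have cy : `|Num.ceil y|%:R <= y + 1.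
  have := ceilB1_lt y; rewrite intrD => /ltW H.
  have c0 : 0 <= Num.ceil y by rewrite ceil_ge0 (lt_le_trans (ltrN10 _) y0).
  by rewrite natr_absz ger0_norm // -lerBlDr.
(* The constant 3 collects the query at [S], the floor at 1 and the rounding up. *)
apply: (@le_trans _ _ (2 + `|Num.ceil y|%:R)); last by lra.
rewrite -[2]/(2%:R) -natrD ler_nat; lia.
Qed.

Lemma card_ground : #|V| = (\sum_i #|Vs i|)%N.
Proof.
have [_ disj cover] := Vs_part; rewrite -cardsT -cover -sum1_card.
rewrite (partition_disjoint_bigcup _ (fun=> 1%N)) //.
by apply: eq_bigr => i _; rewrite sum1_card.
Qed.

Lemma queries_bound : 0 < delta -> delta <= 1 -> (1 < budget cap)%N ->
  (\sum_i \sum_(0 <= s < cap i) (draw_size i s).+1)%:R <=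
  (3 / ln 2 ^+ 2 + (ln 2)^-1 + 1) * #|V|%:R * ln (budget cap)%:R
    * ln ((budget cap)%:R / delta) :> R.
Proof.
move=> d0 d1 b1; set b := budget cap in b1 *.
have bd : 2 <= b%:R / delta :> R.
  rewrite ler_pdivlMr // (@le_trans _ _ 2%:R) ?ler_nat //.
  by rewrite ler_piMr.
have l2 : 0 < ln 2 :> R by rewrite ln_gt0 // ltr1n.
have Lge : ln 2 <= ln (b%:R / delta) by rewrite ler_ln ?posrE // (lt_le_trans _ bd).
have Bge : ln 2 <= ln b%:R :> R by rewrite ler_ln ?posrE ?ltr0n ?ler_nat // ltnW.
set L := ln (b%:R / delta) in Lge *; set B := ln b%:R in Bge *.
have part i : (\sum_(0 <= s < cap i) (draw_size i s).+1)%:R <=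
    3 * (cap i)%:R + #|Vs i|%:R * L * (1 + B).
  have /andP [c0 cV] := cap_le i.
  apply: (@le_trans _ _ (\sum_(0 <= s < cap i)
      (3 + #|Vs i|%:R * L * (cap i - s)%:R^-1))).
    rewrite natr_sum big_nat_cond [leRHS]big_nat_cond.
    by apply: ler_sum => s /andP [/andP [_ lts] _]; exact: draw_size_ub.
  rewrite big_split /= sumr_const_nat subn0 -[3 *+ _]mulr_natr lerD2l -mulr_sumr.
  apply: ler_wpM2l; first by rewrite mulr_ge0 //; lra.
  (* Reversing the order turns the sum of [1 / (cap i - s)] into a harmonic sum. *)
  rewrite big_nat_rev /= add0n.
  apply: (@le_trans _ _ (1 + ln (cap i)%:R)); last first.
    rewrite lerD2l ler_ln ?posrE ?ltr0n // ?ler_nat; last by rewrite ltnW.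
    by rewrite /b /budget (bigD1 i) //= leq_addr.
  apply: le_trans (harmonic_le_ln c0); rewrite big_nat_cond [leRHS]big_nat_cond.
  apply: ler_sum => s /andP [/andP [_ lts] _].
  by rewrite (_ : (cap i - (cap i - s.+1) = s.+1)%N) //; lia.
rewrite natr_sum (le_trans (ler_sum _ (fun i _ => part i))) //.
rewrite big_split /= -mulr_sumr -natr_sum -!mulr_suml -natr_sum -card_ground.
have bV : b%:R <= #|V|%:R :> R.
  rewrite ler_nat card_ground; apply: leq_sum => i _; by case/andP: (cap_le i).
rewrite -/(budget cap) -/b.
have V0 : 0 <= #|V|%:R :> R by [].
have l2V : ln 2 * (ln 2)^-1 = 1 :> R by rewrite divff // gt_eqF.
have iV0 : 0 <= (ln 2)^-1 :> R by rewrite invr_ge0 ltW.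
(* With [z = 1 / ln 2], both [z * L] and [z * B] are at least 1, which absorbs the lower-order terms
   [3 b] and [n L] into multiples of [n B L]. *)
rewrite -exprVn; move: (ln 2)^-1 l2V iV0 => z l2V iV0.
have zL : 1 <= z * L by rewrite -l2V mulrC ler_wpM2l.
have zB : 1 <= z * B by rewrite -l2V mulrC ler_wpM2l.
have zz : 1 <= (z * L) * (z * B) by rewrite mulr_ege1.
have L0 : 0 <= L by lra.
have -> : (3 * z ^+ 2 + z + 1) * #|V|%:R * B * L =
  3 * (#|V|%:R * ((z * L) * (z * B))) + #|V|%:R * L * (z * B + B) by ring.
apply: lerD; last by rewrite ler_wpM2l ?mulr_ge0 // lerD2r.
by rewrite ler_wpM2l // (le_trans bV) // ler_peMr.
Qed.

(** * Selection rule and expected loss of one exchange *)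

Lemma select_supp S Rt e : select S Rt e != 0 -> e \in Rt.
Proof.
rewrite /select_prob; case: ifP => _; case: ifP => //; rewrite ?eqxx //.
by rewrite inE => /andP [].
Qed.

Hypothesis f_mono : monotone f.

Lemma select_ge0 S Rt e : 0 <= select S Rt e.
Proof.
have w0 u : 0 <= weight f gamma' alpha' S Rt u.
  by rewrite exprn_ge0 // marginal_ge0.
rewrite /select_prob; case: ifP => _; case: ifP => // _; first by rewrite invr_ge0.
by rewrite divr_ge0 // sumr_ge0.
Qed.

Lemma sample_ge0 i S Rt : 0 <= sample i S Rt.
Proof. by rewrite /sample_prob; case: ifP => // _; rewrite invr_ge0. Qed.

Lemma step_ge0 st x : 0 <= step st x.
Proof.
by rewrite /step_prob; case: (pending st) => // i _; rewrite mulr_ge0 ?sample_ge0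
  ?select_ge0.
Qed.

Hypothesis gamma0 : 0 < gamma'.
Hypothesis gamma1 : gamma' <= 1.
Hypothesis alpha0 : 0 <= alpha'.
Hypothesis alpha1 : alpha' <= 1.

(** Regular case: [power_selection_le] with [eps = 1 / (N + 2)]. For an infinite exponent [d = 0]
    and only elements of largest marginal are chosen; for vanishing weights the marginal of [o] is
    0. *)
Lemma select_mean_ge S Rt o (N : nat) : o \in Rt -> (#|Rt| <= N)%N ->
  marginal f o S * (1 - (1 - gamma' * (1 - alpha')) * select S Rt o)
    <= (1 - (1 - gamma' * (1 - alpha')) / (N%:R + 2))
       * \sum_e select S Rt e * marginal f e S.
Proof.
move=> oR RN; set d := 1 - gamma' * (1 - alpha').
have x0 u : 0 <= marginal f u S by exact: marginal_ge0.
have d0 : 0 <= d.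
  by rewrite subr_ge0 mulr_ile1 ?subr_ge0 ?(ltW gamma0) // gerBl.
have d1 : d <= 1 by rewrite gerBl mulr_ge0 ?subr_ge0 // ltW.
have N2 : 2 <= N%:R + 2 :> R by rewrite lerDr.
have de1 : d / (N%:R + 2) <= 1 by rewrite ler_pdivrMr; lra.
have E0 : 0 <= \sum_e select S Rt e * marginal f e S.
  by apply: sumr_ge0 => e _; rewrite mulr_ge0 ?select_ge0.
have [C|] := boolP (gamma' * (1 - alpha') == 1).
  have -> : d = 0 by rewrite /d (eqP C) subrr.
  have Rn : Rt != set0 by apply/set0Pn; exists o.
  rewrite !mul0r subr0 mulr1 mul1r.
  rewrite -[leLHS]mul1r -(select_prob_sum1 f gamma' alpha' S Rn) mulr_suml.
  apply: ler_sum => e _; rewrite /select_prob C /=; case: ifP; rewrite ?mul0r //.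
  rewrite inE => /andP [_ /forall_inP max].
  by apply: ler_wpM2l; [rewrite invr_ge0 | exact: max].
move=> C; have [W0|W0] := eqVneq (\sum_(u in Rt) weight f gamma' alpha' S Rt u) 0.
  suff -> : marginal f o S = 0 by rewrite mul0r mulr_ge0 // subr_ge0.
  move/eqP: W0; rewrite psumr_eq0 => [|u _]; last by rewrite exprn_ge0.
  by move=> /allP /(_ o (mem_index_enum _)); rewrite oR /= expf_eq0 => /andP [_ /eqP].
have dp : 0 < d by rewrite lt_neqAle d0 andbT eq_sym subr_eq0 eq_sym.
have [a1 a2] := ceil_exponent_bounds #|Rt| dp.
rewrite -/(exponent gamma' alpha' Rt) in a1 a2.
set a := exponent _ _ _ in a1 a2.
have selE e : e \in Rt -> select S Rt e = marginal f e S ^+ a /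
    \sum_(u in Rt) marginal f u S ^+ a.
  by move=> eR; rewrite /select_prob (negPf C) (negPf W0) eR.
have -> : \sum_e select S Rt e * marginal f e S =
    (\sum_(e in Rt) marginal f e S ^+ a.+1) / \sum_(u in Rt) marginal f u S ^+ a.
  rewrite (bigID (mem Rt)) /= [X in _ + X]big1 ?addr0 => [|e eR].
    by rewrite mulr_suml; apply: eq_bigr => e eR; rewrite selE // exprS; ring.
  have [->|/select_supp] := eqVneq (select S Rt e) 0; first by rewrite mul0r.
  by rewrite (negPf eR).
rewrite selE //.
have Wp : 0 < \sum_(u in Rt) marginal f u S ^+ a.
  by rewrite lt_neqAle eq_sym W0 sumr_ge0 // => u _; rewrite exprn_ge0.
rewrite -(ler_pM2r Wp) -mulrA -[leRHS]mulrA divfK ?gt_eqF //.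
rewrite [X in _ * X <= _]mulrBl mul1r -[X in _ - X]mulrA divfK ?gt_eqF //.
have RNr : #|Rt|%:R <= N%:R :> R by rewrite ler_nat.
have eps0 : 0 < (N%:R + 2)^-1 :> R by rewrite invr_gt0; lra.
have epsN : (N%:R + 2) * (N%:R + 2)^-1 = 1 :> R by rewrite divff // gt_eqF //; lra.
have r0 : 0 <= #|Rt|%:R :> R by [].
(* The value [N + 2] comes from [d (a + 1) <= #|Rt| + 1 + d <= N + 2], where [d <= 1]. *)
apply: (@power_selection_le _ _ _ (fun u => marginal f u S)) => //.
- exact: ltW.
- by move: ((N%:R + 2)^-1) (a%:R) eps0 epsN a1 a2 => e b e0 eN; nra.
move: ((N%:R + 2)^-1) (a%:R) eps0 epsN a1 a2 => e b e0 eN h1 h2.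
rewrite mulrAC.
have e1 : 0 <= 1 - e by nra.
have := ler_wpM2r e1 h1; nra.
Qed.

Hypothesis dr_bound : pm_dr_bound Vs cap f gamma'.
Hypothesis curv_bound : pm_curvature_bound Vs cap f alpha'.

(** The value 0 at [e == o] is what later produces the term in [select S Rt o] of
    [select_mean_ge]. *)
Lemma exchange_loss st O i Rt o e : hybrid_inv st O ->
  Rt \subset Vs i :\: cur st -> o \in argmaxs f (cur st) (Rt :&: O) -> e \in Rt ->
  f (cur st :|: O) - f ((e |: cur st) :|: (O :\ exchange (cur st) O Rt e)) <=
  if e == o then 0 else
    gamma'^-1 * marginal f o (cur st) - (1 - alpha') * marginal f e (cur st).
Proof.
move=> [_ dis tot] sub; rewrite inE => /andP [oRO /forall_inP omax] eR.
set S := cur st in dis tot sub omax *.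
have x0 u : 0 <= marginal f u S by exact: marginal_ge0.
have g1 : 1 <= gamma'^-1 by rewrite invf_ge1.
have [eO|eO] := boolP (e \in O).
  rewrite /exchange eO.
  have -> : (e |: S) :|: (O :\ e) = S :|: O.
    by apply/setP => x; rewrite !inE; case: eqVneq => [->|//]; rewrite eO orbT.
  rewrite subrr; case: ifP => // _; rewrite subr_ge0.
  have := omax e; rewrite inE eR eO => /(_ isT) le.
  apply: (@le_trans _ _ (marginal f e S)); first by rewrite ler_piMl // gerBl.
  by rewrite (le_trans le) // ler_peMl.
have RO : Rt :&: O != set0 by apply/set0Pn; exists o.
have := exchange_in S RO eR; set o' := exchange _ _ _ _ => o'RO.
have [o'R o'O] := setIP o'RO.
have -> : (e == o) = false.
  by apply: contraNF eO => /eqP ->; case/setIP: oRO.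
have /setDP [_ eS] := subsetP sub _ eR.
have o'S : o' \notin S by rewrite (disjointFr dis o'O).
(* Both hybrid solutions are [W] plus one element, and [W :\: S] lies in [O], so the pair [S], [W]
   is admissible: the ratio bounds what removing [o'] loses, the curvature what adding [e] gains. *)
pose W := S :|: (O :\ o').
have -> : S :|: O = o' |: W.
  by apply/setP => x; rewrite !inE; case: eqVneq => [->|//]; rewrite o'O orbT.
have -> : (e |: S) :|: (O :\ o') = e |: W by rewrite setUA.
have o'W : o' \notin W by rewrite !inE eqxx orbF.
have eW : e \notin W by rewrite !inE negb_or eS (negPf eO) andbF.
have cl : pm_close Vs cap S W.
  split=> [|j]; first exact: subsetUl.
  rewrite -tot (leq_trans _ (leq_addr _ _)) // subset_leq_card //.
  apply/subsetP => x; rewrite !inE => /andP [/andP [/negPf ->]] /=.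
  by case/andP=> _ -> ->.
have := dr_bound cl o'W gamma0; have := curv_bound cl eW.
have : gamma'^-1 * marginal f o' S <= gamma'^-1 * marginal f o S.
  by rewrite ler_wpM2l ?omax // ltW // invr_gt0.
rewrite /marginal; lra.
Qed.

Definition loss_ratio (N : nat) : R :=
  (gamma'^-1 + alpha' - 1) * (1 - (N%:R + 2)^-1).

(** The potential [f (S :|: O) + kappa * f S] does not decrease in expectation at an iteration whose
    sample hits [O]. *)
Lemma step_gain st O i Rt (N : nat) : hybrid_inv st O ->
  Rt \subset Vs i :\: cur st -> Rt :&: O != set0 -> (#|Rt| <= N)%N ->
  f (cur st :|: O) + loss_ratio N * f (cur st) <=
  \sum_e select (cur st) Rt e *
    (f ((e |: cur st) :|: (O :\ exchange (cur st) O Rt e))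
     + loss_ratio N * f (e |: cur st)).
Proof.
move=> I sub RO RN; set kappa := loss_ratio N.
 have [o oA] := set0Pn _ (argmaxs_neq0 (cur st) RO).
have oR : o \in Rt by move: oA; rewrite !inE => /andP [/andP []].
have Rn : Rt != set0 by apply/set0Pn; exists o.
set S := cur st in oA *; pose p e := select S Rt e; pose x e := marginal f e S.
have p1 : \sum_e p e = 1 by exact: select_prob_sum1.
set M : R := \sum_e p e * x e.
have main : \sum_e p e * (f (S :|: O) - f ((e |: S) :|: (O :\ exchange S O Rt e)))
    <= kappa * M.
  (* This identity is where the form of [loss_ratio] comes from. *)
  have -> : kappa * M = gamma'^-1 * ((1 - (1 - gamma' * (1 - alpha')) / (N%:R + 2)) * M)
      - (1 - alpha') * M.
    rewrite /kappa /loss_ratio; move: ((N%:R + 2)^-1) => z.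
    by field; rewrite gt_eqF.
  have := select_mean_ge S oR RN; rewrite /= -/(x o) -/(p o) -/M => mean.
  apply: (@le_trans _ _ (gamma'^-1 * (x o * (1 - (1 - gamma' * (1 - alpha')) * p o))
      - (1 - alpha') * M)); last first.
    by rewrite lerD2r ler_wpM2l // ltW // invr_gt0.
  have -> : gamma'^-1 * (x o * (1 - (1 - gamma' * (1 - alpha')) * p o))
      - (1 - alpha') * M = \sum_e (p e * (gamma'^-1 * x o - (1 - alpha') * x e) -
        if e == o then p o * (gamma'^-1 * x o - (1 - alpha') * x o) else 0).
    rewrite sumrB -big_mkcond big_pred1_eq.
    under eq_bigr do rewrite mulrBr [p _ * ((1 - alpha') * _)]mulrCA.
    rewrite sumrB -mulr_suml -mulr_sumr p1 -/M.
    by field; rewrite gt_eqF.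
  apply: ler_sum => e _; have [pz|nz] := eqVneq (p e) 0.
    by case: (eqVneq e o) => [<-|_]; rewrite pz !mul0r subr0.
  have := exchange_loss I sub oA (select_supp nz); rewrite -/S -/(x o) -/(x e).
  have : 0 <= p e by exact: select_ge0.
  case: eqVneq => [->|_] pe0 loss; rewrite ?subrr ?subr0; last by rewrite ler_wpM2l.
  by rewrite mulr_ge0_le0.
rewrite -[leLHS]mul1r -p1 mulr_suml -subr_ge0 -sumrB.
have -> : \sum_e (p e * (f ((e |: S) :|: (O :\ exchange S O Rt e)) + kappa * f (e |: S))
    - p e * (f (S :|: O) + kappa * f S)) = kappa * M -
    \sum_e p e * (f (S :|: O) - f ((e |: S) :|: (O :\ exchange S O Rt e))).
  rewrite /M mulr_sumr -sumrB; apply: eq_bigr => e _; rewrite /x /marginal; ring.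
by rewrite subr_ge0.
Qed.

(** [step_gain] is iterated over hitting trajectories, the later hit probability being a common
    factor. At the end all parts are full, so [O] is empty and the potential equals
    [(kappa + 1) * f] of the output. *)
Lemma hits_expect n st O : hybrid_inv st O -> steps_left st = n ->
  (f (cur st :|: O) + loss_ratio (max_part Vs) * f (cur st))
    * all_hit_prob (cur st) <=
  (loss_ratio (max_part Vs) + 1) * \sum_(w : n.-tuple ({set V} * V) | hits st O w)
    path_prob st w * f (cur (foldl (fun st x => next st x.2) st w)).
Proof.
set kappa := loss_ratio _; elim: n st O => [|n IH] st O I L.
  have [I0 _ tot] := I.
  have O0 : O = set0.
    apply/setP => x; rewrite inE; apply/negP => xO.
    have [_ _ cover] := Vs_part; have : x \in [set: V] by rewrite inE.
    rewrite -cover => /bigcupP [i _ xV].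
    have /eqP := tot i; rewrite -(steps_left0 I0 L i) -[X in _ == X]add0n eqn_add2r.
    by rewrite cards_eq0 => /eqP /setP /(_ x); rewrite !inE xO xV.
  rewrite -(sum_hits I L) O0 setU0 !(big_pred1 [tuple]) /= => [|w|w].
  - by rewrite mulr1 mul1r mulrDl mul1r addrC.
  - by rewrite (tuple0 w) /= eqxx.
  - by rewrite (tuple0 w) /= eqxx.
have [I0 _ _] := I; have [i [q [P lti]]] := pending_cons I0 L.
rewrite (sum_hits_cons _ _ _ (fun w => f (cur (foldl (fun st x => next st x.2) st w)))).
pose c := all_hit_prob (cur st) / hit_prob i #|cur st :&: Vs i|.
have c0 : 0 <= c by rewrite divr_ge0 // ltW ?all_hit_prob_gt0 ?hit_prob_gt0.
pose g x : R := f ((x.2 |: cur st) :|: (O :\ exchange (cur st) O x.1 x.2))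
  + kappa * f (x.2 |: cur st).
apply: (@le_trans _ _ (\sum_(x | x.1 :&: O != set0) step st x * (g x * c))); last first.
  rewrite mulr_sumr; apply: ler_sum => x h; rewrite [leRHS]mulrCA.
  have [->|nz] := eqVneq (step st x) 0; first by rewrite !mul0r.
  have [sub xin I' L'] := step_hit_next I P L h nz.
  apply: ler_wpM2l; first exact: step_ge0.
  have := IH _ _ I' L'; rewrite (cur_next _ P).
  by rewrite (all_hit_prob_next (subsetP sub _ xin) lti).
rewrite (sum_step_hit _ (fun x => g x * c) P).
have -> : all_hit_prob (cur st) = hit_prob i #|cur st :&: Vs i| * c.
  by rewrite /c mulrCA divff ?mulr1 // gt_eqF // hit_prob_gt0.
rewrite -(sum_sample_hit i I) mulrC mulr_suml mulr_suml.
apply: ler_sum => Rt h; rewrite -mulrA.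
have [->|nz] := eqVneq (sample i (cur st) Rt) 0; first by rewrite !mul0r.
apply: ler_wpM2l; first exact: sample_ge0.
have sub : Rt \subset Vs i :\: cur st.
  by move: nz; rewrite /sample_prob; case: ifP => [/andP []|]; rewrite ?eqxx.
have RN : (#|Rt| <= max_part Vs)%N.
  apply: leq_trans (leq_bigmax i); apply: subset_leq_card.
  by apply: subset_trans sub (subsetDl _ _).
under eq_bigr do rewrite mulrA.
by rewrite -mulr_suml mulrC ler_wpM2r //; exact: step_gain I sub h RN.
Qed.

End HybridAnalysis.

(** * The approximation guarantee and the query bound for a complete run *)

Theorem theorem2 (R : realType) :
  exists C : R,
  forall (V : finType) (k : nat) (Vs : 'I_k -> {set V}) (cap : 'I_k -> nat)
    (f : {set V} -> R) (gamma alpha gamma' alpha' delta : R)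
    (Sstar : {set V}),
  (0 < k)%N ->
  is_partition Vs ->
  (forall i, (1 <= cap i <= #|Vs i|)%N) ->
  (forall S, 0 <= f S) ->
  monotone f ->
  f set0 = 0 ->
  is_pm_dr_ratio Vs cap f gamma ->
  is_pm_curvature Vs cap f alpha ->
  0 < gamma' -> gamma' <= gamma ->
  alpha <= alpha' -> alpha' <= 1 ->
  0 <= delta -> delta <= 1 ->
  is_optimal Vs cap f Sstar ->
  (exists G : {set trajectory cap},
    [/\ sampling_event Vs f gamma' alpha' delta G,
        1 - delta <= Pr Vs f gamma' alpha' delta G
      & f Sstar <=
          ((gamma'^-1 + alpha' - 1) * (1 - ((max_part Vs)%:R + 2)^-1) + 1)
          * cond_expect Vs f gamma' alpha' delta G
              (fun w => f (output Vs w))])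
  /\
  ((1 < budget cap)%N -> 0 < delta ->
    forall w : trajectory cap,
      0 < traj_prob Vs f gamma' alpha' delta w ->
      (num_queries Vs w)%:R <=
        C * #|V|%:R * ln (budget cap)%:R * ln ((budget cap)%:R / delta)).
Proof.
exists (3 / ln 2 ^+ 2 + (ln 2)^-1 + 1) => V k Vs cap f gamma alpha gamma' alpha'.
move=> delta Sstar k0 part capV _ mono f0 [/andP [_ gamma1] dr _].
move=> [/andP [alpha0 _] curv _] g'0 g'le ale a'1 d0 d1 [feas _].
have b0 : (0 < budget cap)%N.
  rewrite /budget (bigD1 (Ordinal k0)) //= ltn_addr //.
  by case/andP: (capV (Ordinal k0)).
have g'1 := le_trans g'le gamma1; have a'0 := le_trans alpha0 ale.
have gp := lt_le_trans g'0 g'le.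
(* Marginals are nonnegative by monotonicity, so the bounds for [gamma] and [alpha] weaken to
   [gamma'] and [alpha']. *)
have dr' : pm_dr_bound Vs cap f gamma'.
  move=> S T e cl eT _; apply: le_trans (dr S T e cl eT gp) _.
  by rewrite ler_wpM2r ?marginal_ge0 // lef_pV2.
have curv' : pm_curvature_bound Vs cap f alpha'.
  move=> S T e cl eT; apply: le_trans (curv S T e cl eT).
  by rewrite ler_wpM2r ?marginal_ge0 // lerD2l lerN2.
have I0 : loop_inv Vs cap init_state by exact: inv_init.
have L0 : steps_left Vs cap init_state = budget cap by exact: left_init.
split; last first.
  move=> b1 dp w wp; pose x0 := tnth w (Ordinal b0).
  have E := queries_from part x0 I0 L0 (lt0r_neq0 wp).
  rewrite (_ : num_queries Vs w =
    \sum_i \sum_(0 <= s < cap i) (draw_size Vs cap delta i s).+1)%N.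
    exact: queries_bound.
  transitivity (\sum_i \sum_(#|set0 :&: Vs i| <= s < cap i)
    (draw_size Vs cap delta i s).+1)%N; last first.
    by apply: eq_bigr => i _; rewrite set0I cards0.
  by rewrite -[RHS]E; apply: eq_bigr => t _; rewrite (tnth_nth x0).
have [T ST capT] := feasible_extend part capV feas.
have I : hybrid_inv Vs cap init_state T.
  split=> [//||i]; first by rewrite -setI_eq0 setI0.
  by rewrite capT set0I cards0 addn0.
pose G := [set w : trajectory cap | hits Vs cap f init_state T w].
have PrG : Pr Vs f gamma' alpha' delta G = all_hit_prob Vs cap delta set0.
  rewrite -[RHS](sum_hits f gamma' alpha' delta part capV I L0).
  by apply: eq_bigl => w; rewrite inE.
exists G; split.
- move=> t w; pose x0 := tnth w t; rewrite !(tnth_nth x0).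
  have := hits_select f gamma' alpha' delta part capV x0 w I L0 (ltn_ord t).
  rewrite /Pr /traj_prob; move=> E.
  rewrite (eq_bigl (fun w' : trajectory cap => hits Vs cap f init_state T w' &&
    (take t.+1 w' == take t.+1 w))) => [|w']; last by rewrite !inE.
  rewrite E; congr (_ * _); apply: eq_bigl => w'.
  by rewrite !inE (tnth_nth x0).
- by rewrite PrG all_hit_prob0_ge.
have P0 : 0 < Pr Vs f gamma' alpha' delta G by rewrite PrG all_hit_prob_gt0.
apply: le_trans (mono _ _ ST) _.
rewrite /cond_expect mulrA ler_pdivlMr // PrG.
have := hits_expect delta part capV mono g'0 g'1 a'0 a'1 dr' curv' I L0.
(* The initial potential is [f T], because [f set0 = 0]. *)
rewrite /= set0U f0 mulr0 addr0 => /le_trans; apply.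
rewrite le_eqVlt; apply/orP; left; apply/eqP; congr (_ * _).
by apply: eq_bigl => w; rewrite inE.
Qed.
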